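(* Let $G$ be a finite connected simple graph without isolated vertices on the vertex set $[n]$, let $K$ be a field, let $S=K[x_1,\dots,x_n,y_1,\dots,y_n]$, and let $J_G\subseteq S$ be the binomial edge ideal of $G$. The following conditions are equivalent: (1) The graph $G$ is closed, i.e. there exists a labelling of its vertices with respect to which $G$ is closed. (2) The clique complex $\Delta(G)$ is closed. (3) The binomial edge ideal $J_G$ has a quadratic Gröbner basis with respect to some term order on $S$.
   Context: Binomial edge ideal: $J_G$ is the ideal of $S$ generated by all $f_{ij}=x_iy_j-x_jy_i$ with $i<j$ and $\{i,j\}\in E(G)$. A term order is a monomial order on $S$. A quadratic Gröbner basis is a Gröbner basis all of whose elements are homogeneous of degree $2$. Closed graph: a labelling of $G$ is a bijection $\omega:V(G)\to[n]$. $G$ is closed with respect to $\omega$ if for any two distinct edges $\{u,v\},\{u,w\}\in E(G)$ with either $\omega(u)<\omega(v)$ and $\omega(u)<\omega(w)$, or $\omega(u)>\omega(v)$ and $\omega(u)>\omega(w)$, one has $\{v,w\}\in E(G)$. The clique complex $\Delta(G)$ is the simplicial complex on $V(G)$ whose faces are the cliques of $G$. $\langle F_i,\dots,F_q\rangle$ denotes the simplicial complex with facets $F_i,\dots,F_q$. Leaf and branch: a facet $F$ of a simplicial complex $\Delta$ is a leaf of $\Delta$ if either $F$ is the only facet of $\Delta$, or there is a facet $B\ne F$ of $\Delta$, called a branch of $F$, such that $H\cap F\subseteq B\cap F$ for all facets $H\neq F$ of $\Delta$. Linear quasi-tree: a simplicial complex $\Delta$ is a linear quasi-tree if there is an ordering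 $F_1,\dots,F_q$ of its (distinct) facets such that (1) $F_i$ is a leaf of the subcomplex $\langle F_i,\dots,F_q\rangle$ for all $i$; and (2) for all $i<q$, $F_{i+1}$ is the only branch of $F_i$ in $\langle F_i,\dots,F_q\rangle$. Such an ordering is called a leaf order. Closed complex: $\Delta$ is closed if it is a linear quasi-tree $\Delta=\langle F_1,\dots,F_r\rangle$, with leaf order $F_1,\dots,F_r$, such that, with $F_{i,j}=F_i\cap F_j$ for $1\le i\le j\le r$ (so $F_{i,i}=F_i$) and $F_{i,j}=\emptyset$ if $i<1$ or $j>r$: (I) for all $1\le i\le j\le r$ and $1\le k\le\ell\le r$ with $i<k$ and $j<\ell$, the sets $F_{i,j}$ and $F_{k,\ell}$ are not comparable under inclusion, or at least one of them is empty; (C) for all $i\in[r]$ and $d\ge1$ with $F_{i,i+d+1}\neq\emptyset$, one has $F_{i+1,i+d}=F_{i,i+d}\cup F_{i+1,i+d+1}$. *)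

(* Defs.v *)
From mathcomp Require Import all_boot all_order all_algebra.
From mathcomp Require Export mpoly.

Set Implicit Arguments.
Unset Strict Implicit.
Unset Printing Implicit Defensive.

Import GRing.Theory.

Section Graphs.

(* A simple graph on a finite type is given by its adjacency relation, assumed
   symmetric and irreflexive. *)

Definition graph_connected (T : finType) (e : rel T) : Prop :=
  (0 < #|T|)%N /\ forall u v, connect e u v.

Definition no_isolated_vertex (T : finType) (e : rel T) : Prop :=
  forall u, exists v, e u v.

(* [v != w] says that the edges {u,v} and {u,w} are distinct. *)
Definition closed_wrt (n : nat) (e : rel 'I_n) (w : 'I_n -> 'I_n) : Prop :=
  forall u v v' : 'I_n, e u v -> e u v' -> v != v' ->
    (w u < w v)%N && (w u < w v')%N || (w v < w u)%N && (w v' < w u)%N ->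
    e v v'.

Definition closed_graph (n : nat) (e : rel 'I_n) : Prop :=
  exists2 w : 'I_n -> 'I_n, bijective w & closed_wrt e w.

Definition clique (T : finType) (e : rel T) (A : {set T}) : bool :=
  [forall u in A, forall v in A, (u != v) ==> e u v].

End Graphs.

Section SimplicialComplexes.

(* A simplicial complex on T is given by the set D of its faces. *)
Variable T : finType.
Implicit Types (D : {set {set T}}) (F B : {set T}) (s : seq {set T}).

Definition facets D : {set {set T}} :=
  [set F | maxset (fun A : {set T} => A \in D) F].

Definition complex_of s : {set {set T}} :=
  [set A : {set T} | has (fun F : {set T} => A \subset F) s].

Definition is_branch D F B : bool :=
  [&& B \in facets D, B != F
    & [forall H in facets D, (H != F) ==> (H :&: F \subset B :&: F)]].

Definition is_leaf D F : bool :=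
  (F \in facets D) &&
  ((facets D == [set F]) || [exists B, is_branch D F B]).

(* Facets are numbered from 0. A linear quasi-tree is a complex admitting a
   leaf order. *)
Definition leaf_order D s : Prop :=
  [/\ uniq s, s =i facets D,
      forall i, (i < size s)%N ->
        is_leaf (complex_of (drop i s)) (nth set0 s i)
    & forall i, (i.+1 < size s)%N -> forall B,
        is_branch (complex_of (drop i s)) (nth set0 s i) B
          <-> B = nth set0 s i.+1].

(* F_{i,j}; it is empty as soon as an index is out of range. *)
Definition facetI s (i j : nat) : {set T} := nth set0 s i :&: nth set0 s j.

Definition closed_condI s : Prop :=
  forall i j k l : nat,
    (i <= j < size s)%N -> (k <= l < size s)%N -> (i < k)%N -> (j < l)%N ->
    ~~ (facetI s i j \subset facetI s k l) /\
    ~~ (facetI s k l \subset facetI s i j) \/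
    facetI s i j = set0 \/ facetI s k l = set0.

Definition closed_condC s : Prop :=
  forall i d : nat, (i < size s)%N -> (1 <= d)%N ->
    facetI s i (i + d + 1) <> set0 ->
    facetI s (i + 1) (i + d) =
      facetI s i (i + d) :|: facetI s (i + 1) (i + d + 1).

Definition closed_complex D : Prop :=
  exists s, [/\ leaf_order D s, closed_condI s & closed_condC s].

End SimplicialComplexes.

Definition clique_complex (T : finType) (e : rel T) : {set {set T}} :=
  [set A : {set T} | clique e A].

Local Open Scope ring_scope.

Definition ideal_gen (R : comNzRingType) (P : R -> Prop) (p : R) : Prop :=
  exists2 s : seq (R * R),
    (forall c, c \in s -> P c.2) & p = \sum_(c <- s) c.1 * c.2.

Section GroebnerBases.

Variable N : nat.

Definition term_order (le : rel 'X_{1..N}) : Prop :=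
  [/\ reflexive le /\ antisymmetric le, transitive le, total le,
      forall m, le 0%MM m
    & forall m1 m2 m, le m1 m2 -> le (m1 + m)%MM (m2 + m)%MM].

Variable K : fieldType.
Implicit Types (le : rel 'X_{1..N}) (I : {mpoly K[N]} -> Prop).

(* [m] is the leading monomial of [p] for [le]; in particular [p != 0]. The
   library's [mlead] is tied to one particular order. *)
Definition is_lead le (p : {mpoly K[N]}) (m : 'X_{1..N}) : Prop :=
  m \in msupp p /\ forall m', m' \in msupp p -> le m' m.

(* The ideal generated by the leading monomials of the elements of P. *)
Definition lead_ideal le (P : {mpoly K[N]} -> Prop) : {mpoly K[N]} -> Prop :=
  ideal_gen (fun q => exists p m, [/\ P p, is_lead le p m & q = 'X_[m]]).

Definition groebner_basis le I (g : seq {mpoly K[N]}) : Prop :=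
  (forall p, p \in g -> I p /\ p != 0) /\
  (forall q, lead_ideal le I q <-> lead_ideal le (fun p => p \in g) q).

Definition quadratic_groebner_basis le I (g : seq {mpoly K[N]}) : Prop :=
  groebner_basis le I g /\ forall p, p \in g -> p \is 2.-homog.

End GroebnerBases.

(* In K[x_1, ..., x_n, y_1, ..., y_n], the first n variables are the x_i and
   the last n ones are the y_i. *)
Definition binom_edge (K : fieldType) (n : nat) (i j : 'I_n) :
    {mpoly K[n + n]} :=
  'X_(lshift n i) * 'X_(rshift n j) - 'X_(lshift n j) * 'X_(rshift n i).

Definition binomial_edge_ideal (K : fieldType) (n : nat) (e : rel 'I_n) :
    {mpoly K[n + n]} -> Prop :=
  ideal_gen (fun f => exists i j : 'I_n,
    [/\ (i < j)%N, e i j & f = binom_edge K i j]).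
Arguments binomial_edge_ideal K {n} e _.

(* Main.v *)
(** (1) <=> (2): a labelling of a connected graph for which the graph is closed
    makes every clique facet an interval of labels; sorting the facets by their
    least label gives the leaf order, and (I), (C) become statements about
    interval endpoints. Conversely, in a leaf order the facets containing a given
    vertex have consecutive indices, condition (C) forbids one such index interval
    to lie strictly inside another, and ordering the vertices by these intervals
    gives a closed labelling.

    (1) => (3): no Buchberger criterion is needed. If a set of monomials is stable
    under the exchanges x_i y_j <-> x_j y_i along edges, then the coefficients of
    any element of J_G sum to 0 over that set. For the graded lexicographic order
    following the labelling, a monomial divisible by no x_i y_j with i < j an edge is the
    smallest of such a set, hence is never a leading monomial of an element of J_G.

    (3) => (1): cancellation shows that "x_u y_v is larger than x_v y_u" is a total
    order on the vertices. If v, v' are both above or both below a common neighbour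
    u, the S-polynomial of f_{uv} and f_{uv'} is t f_{vv'} with t = y_u or t = x_u;
    a quadratic leading monomial can divide its leading term only if v v' is an
    edge. *)

Require Import Defs.
From mathcomp Require Import all_boot all_algebra.
From mathcomp Require Import all_order zify ring.

Set Implicit Arguments.
Unset Strict Implicit.
Unset Printing Implicit Defensive.

(** * Closed labellings *)

Section ClosedLabelling.

Variables (n : nat) (e : rel 'I_n) (w : 'I_n -> 'I_n).
Hypotheses (e_sym : symmetric e) (e_irr : irreflexive e).
Hypothesis e_conn : forall u v, connect e u v.
Hypotheses (w_bij : bijective w) (w_closed : closed_wrt e w).

(** Connectivity and closedness will join any two vertices by a path along which labels only
    increase. *)
Definition ascending_edge : rel 'I_n := [rel u v | e u v && (w u < w v)].
Local Notation up := ascending_edge.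

Lemma label_inj u v : w u = w v :> nat -> u = v.
Proof. by move=> /val_inj/(bij_inj w_bij). Qed.

Lemma label_surj k : k < n -> exists u, w u = k :> nat.
Proof.
move=> kn; have [w' _ wK'] := w_bij.
by exists (w' (Ordinal kn)); rewrite wK'.
Qed.

Lemma edge_label_neq u v : e u v -> w u != w v :> nat.
Proof. by apply: contraTneq => /label_inj ->; rewrite e_irr. Qed.

Lemma connect_ascending_edge u v : e u v -> w u < w v -> connect up u v.
Proof. by move=> e_uv lt_uv; apply: connect1; rewrite /up /= e_uv. Qed.

Lemma edge_ascending u v : e u v -> connect up u v || connect up v u.
Proof.
move=> euv; have := edge_label_neq euv; rewrite neq_ltn => /orP[] lt_uv.
  by rewrite connect_ascending_edge.
by rewrite orbC connect_ascending_edge // e_sym.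
Qed.

(** If the added edge goes down from the end [x] of the path, then [v'] and the predecessor of [x]
    are both below [x], so closedness makes them adjacent and the path gets shorter. *)
Lemma ascending_edge_trans u v v' :
  connect up u v -> e v v' -> connect up u v' || connect up v' u.
Proof.
case/connectP=> p; elim/last_ind: p v v' => [|p x IHp] v v' /=.
  by move=> _ ->; apply: edge_ascending.
rewrite rcons_path last_rcons => /andP[up_p /andP[e_yx lt_yx]] -> e_xv'.
have u_y : connect up u (last u p) by apply/connectP; exists p.
have := edge_label_neq e_xv'; rewrite neq_ltn => /orP[lt_xv'|lt_v'x].
  by rewrite (connect_trans u_y) // (@connect_trans _ _ x) ?connect_ascending_edge.
have [<-|ne_yv'] := eqVneq (last u p) v'; first by rewrite u_y.
apply: (IHp (last u p)) => //; apply: (w_closed (u := x)) => //.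
  by rewrite e_sym.
by rewrite lt_yx lt_v'x orbT.
Qed.

(** Mirror image: if [v'] is above [v], it is adjacent to the successor of [v], which is also above
    [v]. *)
Lemma descending_edge_trans u v v' :
  connect up v u -> e v v' -> connect up u v' || connect up v' u.
Proof.
case/connectP=> p; elim: p v v' => [|y p IHp] v v' /=.
  by move=> _ ->; apply: edge_ascending.
move=> /andP[/andP[e_vy lt_vy] up_p] eq_u e_vv'.
have y_u : connect up y u by apply/connectP; exists p.
have := edge_label_neq e_vv'; rewrite neq_ltn => /orP[lt_vv'|lt_v'v].
  have [<-|ne_yv'] := eqVneq y v'; first by rewrite y_u orbT.
  apply: (IHp y) => //; apply: (w_closed (u := v)) => //.
  by rewrite lt_vy lt_vv'.
apply/orP; right; apply: (@connect_trans _ _ v).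
  by rewrite connect_ascending_edge // e_sym.
by apply: connect_trans y_u; rewrite connect_ascending_edge.
Qed.

Lemma connect_ascending u v : connect up u v || connect up v u.
Proof.
have /connectP[p] := e_conn u v; elim/last_ind: p v => [|p x IHp] v /=.
  by move=> _ ->; rewrite connect0.
rewrite rcons_path last_rcons => /andP[e_p e_x] ->.
have /orP[] := IHp _ e_p erefl => h.
  exact: ascending_edge_trans h e_x.
exact: descending_edge_trans h e_x.
Qed.

Lemma connect_ascending_le u v : connect up u v -> w u <= w v.
Proof.
case/connectP=> p; elim: p u => [|y p IHp] u /=; first by move=> _ ->.
by move=> /andP[/andP[_ /ltnW le_uy] /IHp + eqv] => /(_ eqv); apply: leq_trans.
Qed.

(** Labels strictly increase along an ascending path, so between consecutive labels it has a single
    edge. *)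
Lemma edge_consecutive u v : w v = (w u).+1 :> nat -> e u v.
Proof.
move=> wv; have /orP[] := connect_ascending u v; last first.
  by move/connect_ascending_le; lia.
case/connectP=> -[|y p] /=; first by move=> _ eq_vu; move: wv; rewrite eq_vu; lia.
move=> /andP[/andP[e_uy lt_uy] up_p] eq_v.
have /connect_ascending_le : connect up y v by apply/connectP; exists p.
by move=> le_yv; rewrite (@label_inj v y) //; lia.
Qed.

(** The upper end of the edge moves down to [q], then the lower end up to [p], one label at a time.
    Each move applies closedness at the old end, which is adjacent to the next label. *)
Lemma edge_convex i j p q :
  e i j -> w i <= w p -> w p < w q -> w q <= w j -> e p q.
Proof.
move=> e_ij le_ip lt_pq le_qj.
have e_iq : e i q.
  have lt_iq : w i < w q by lia.
  have [d] := ubnP (w j - w q); elim: d q le_qj lt_iq {lt_pq} => // d IHd q.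
  rewrite leq_eqVlt => /orP[/eqP/label_inj -> //|lt_qj] lt_iq lt_d.
  have [q' eq_q'] : exists q', w q' = (w q).+1 :> nat.
    by apply: label_surj; apply: leq_ltn_trans (ltn_ord (w j)).
  have e_iq' : e i q' by apply: IHd; lia.
  apply: (w_closed (u := q')); rewrite 1?e_sym //.
  - exact: edge_consecutive.
  - by apply: contraTneq lt_iq => ->; rewrite ltnn.
  - by apply/orP; right; lia.
have [d] := ubnP (w p - w i); elim: d p le_ip lt_pq => // d IHd p.
rewrite leq_eqVlt => /orP[/eqP/label_inj <- //|lt_ip] lt_pq lt_d.
have [p' eq_p'] : exists p', w p' = (w p).-1 :> nat.
  by apply: label_surj; have := ltn_ord (w p); lia.
have e_p'q : e p' q by apply: IHd; lia.
apply: (w_closed (u := p')) => //.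
- by apply: edge_consecutive; lia.
- by apply: contraTneq lt_pq => ->; rewrite ltnn.
- by apply/orP; left; lia.
Qed.

End ClosedLabelling.

(** * Complexes with interval facets *)

Section Facets.

Variable T : finType.
Implicit Types (D : {set {set T}}) (A B F : {set T}) (s : seq {set T}).

Lemma facetsP D F :
  reflect (F \in D /\ forall A, A \in D -> F \subset A -> A = F) (F \in facets D).
Proof. by rewrite inE; apply: (iffP maxsetP) => -[DF max_F]; split. Qed.

Lemma facets_antichain D A B :
  A \in facets D -> B \in facets D -> A \subset B -> A = B.
Proof.
by move=> /facetsP[_ max_A] /facetsP[DB _] sAB; rewrite (max_A B).
Qed.

Lemma facets_complex_of s :
  {in s &, forall A B, A \subset B -> A = B} -> facets (complex_of s) =i s.
Proof.
move=> anti_s F; apply/facetsP/idP => [[]|sF].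
  rewrite inE => /hasP[A sA sFA] max_F.
  by rewrite -(max_F A) // inE; apply/hasP; exists A.
split; first by rewrite inE; apply/hasP; exists F.
move=> A; rewrite inE => /hasP[B sB sAB] sFA.
by apply/eqP; rewrite eqEsubset sFA andbT (anti_s F B) // (subset_trans sFA).
Qed.

(** Facets form an antichain, and so does any part of them; this identifies the facets of the
    subcomplexes in a leaf order. *)
Lemma facets_drop D s i : s =i facets D -> facets (complex_of (drop i s)) =i drop i s.
Proof.
move=> eq_s; apply: facets_complex_of => A B /mem_drop + /mem_drop.
by rewrite !eq_s; apply: facets_antichain.
Qed.

Lemma mem_dropP s i A :
  reflect (exists2 j, i <= j < size s & A = nth set0 s j) (A \in drop i s).
Proof.
apply: (iffP (nthP set0)) => [[j]|[j ij ->]].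
  by rewrite size_drop nth_drop ltn_subRL => lt_j <-; exists (i + j); rewrite ?leq_addr.
have /andP[le_ij lt_j] := ij; exists (j - i); last by rewrite nth_drop subnKC.
by rewrite size_drop ltn_sub2r // (leq_ltn_trans le_ij).
Qed.

Lemma mem_drop_nth s i j : i <= j < size s -> nth set0 s j \in drop i s.
Proof. by move=> ij; apply/mem_dropP; exists j. Qed.

End Facets.

(** * Facets that are label intervals with increasing endpoints *)

Section IntervalFacets.

Variables (T : finType) (D : {set {set T}}) (s : seq {set T}).
Variables (n : nat) (w : T -> nat) (lo hi : nat -> nat).
Hypothesis (w_surj : forall k, k < n -> exists x, w x = k).
Hypotheses (s_uniq : uniq s) (eq_s : s =i facets D).
Hypothesis mem_s : forall i, i < size s ->
  forall x, (x \in nth set0 s i) = (lo i <= w x <= hi i).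
Hypothesis lo_mono : forall i j, i < j < size s -> lo i < lo j.
Hypothesis hi_mono : forall i j, i < j < size s -> hi i < hi j.
Hypothesis hi_lt : forall i, i < size s -> hi i < n.
Hypothesis lo_le_hi : forall i, i.+1 < size s -> lo i.+1 <= hi i.

Let lo_mono_leq i j : i <= j < size s -> lo i <= lo j.
Proof.
case/andP; rewrite leq_eqVlt => /orP[/eqP->//|lt_ij] lt_j.
by apply/ltnW/lo_mono; rewrite lt_ij.
Qed.

Let hi_mono_leq i j : i <= j < size s -> hi i <= hi j.
Proof.
case/andP; rewrite leq_eqVlt => /orP[/eqP->//|lt_ij] lt_j.
by apply/ltnW/hi_mono; rewrite lt_ij.
Qed.

Let nth_s_eq i j : i < size s -> j < size s ->
  (nth set0 s i == nth set0 s j) = (i == j).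
Proof. by move=> lt_i lt_j; apply: nth_uniq. Qed.

Lemma mem_facetI_interval i j x : i <= j < size s ->
  (x \in facetI s i j) = (lo j <= w x <= hi i).
Proof.
move=> ij; have := lo_mono_leq ij; have := hi_mono_leq ij.
by rewrite inE !mem_s; lia.
Qed.

Lemma facetI_interval_neq0 i j : i <= j < size s ->
  facetI s i j <> set0 -> lo j <= hi i.
Proof.
move=> ij /eqP/set0Pn[x]; rewrite mem_facetI_interval //; lia.
Qed.

(** Every later facet starts at [lo i.+1] or above, so it meets the [i]-th one inside
    [[lo i.+1, hi i]], which the next facet contains. *)
Lemma interval_branch i : i.+1 < size s ->
  is_branch (complex_of (drop i s)) (nth set0 s i) (nth set0 s i.+1).
Proof.
move=> lt_i; apply/and3P; split.
- by rewrite (facets_drop _ eq_s) mem_drop_nth //; lia.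
- by rewrite nth_s_eq //; lia.
- apply/forall_inP => H; rewrite (facets_drop _ eq_s) => /mem_dropP[j ij ->].
  apply/implyP; rewrite nth_s_eq //; [| lia | lia] => ne_ji.
  apply/subsetP => x; rewrite !inE !mem_s; [|lia..].
  have : lo i.+1 <= lo j by apply: lo_mono_leq; lia.
  have : hi i < hi i.+1 by apply: hi_mono; lia.
  lia.
Qed.

Lemma interval_branch_unique i B : i.+1 < size s ->
  is_branch (complex_of (drop i s)) (nth set0 s i) B -> B = nth set0 s i.+1.
Proof.
move=> lt_i /and3P[+ neB /forall_inP brB]; rewrite (facets_drop _ eq_s).
case/mem_dropP=> j ij def_B; rewrite def_B nth_s_eq ?(andP ij).2 // in neB; last by lia.
have [lt_ij|] := ltnP i.+1 j; last by move=> ?; rewrite def_B; congr nth; lia.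
(* This vertex is common to the facets [i] and [i.+1], which overlap, but lies before the facet
   [j]. *)
have [x wx] : exists x, w x = lo i.+1.
  apply: w_surj; apply: leq_ltn_trans (lo_le_hi lt_i) _; apply: hi_lt; lia.
have := brB (nth set0 s i.+1); rewrite (facets_drop _ eq_s) mem_drop_nth; last by lia.
rewrite nth_s_eq //; last by lia.
move=> /(_ isT)/implyP/(_ _)/subsetP; have -> : i.+1 != i by lia.
move=> /(_ isT x); rewrite def_B !inE !mem_s; [|lia..].
have : lo i.+1 < lo j by apply: lo_mono; lia.
have : lo i < lo i.+1 by apply: lo_mono; lia.
have : hi i < hi i.+1 by apply: hi_mono; lia.
have := lo_le_hi lt_i; rewrite wx; lia.
Qed.

Lemma interval_leaf i : i < size s ->
  is_leaf (complex_of (drop i s)) (nth set0 s i).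
Proof.
move=> lt_i; rewrite /is_leaf (facets_drop _ eq_s) mem_drop_nth ?leqnn //=.
have [lt_i1|le_si] := ltnP i.+1 (size s).
  by apply/orP; right; apply/existsP; exists (nth set0 s i.+1); apply: interval_branch.
apply/orP; left; apply/eqP/setP => F; rewrite (facets_drop _ eq_s) inE.
apply/mem_dropP/eqP => [[j ij ->]|->]; last by exists i; rewrite ?leqnn.
by congr nth; lia.
Qed.

(** [F_{i,j}] is the interval [[lo j, hi i]]: its least label lies below [F_{k,l}], and the greatest
    label [hi k] of [F_{k,l}] lies above [F_{i,j}]. *)
Lemma interval_closed_condI : closed_condI s.
Proof.
move=> i j k l ij kl ik jl.
have [->|/eqP n0ij] := eqVneq (facetI s i j) set0; first by right; left.
have [->|/eqP n0kl] := eqVneq (facetI s k l) set0; first by right; right.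
left; have le_ji := facetI_interval_neq0 ij n0ij.
have le_lk := facetI_interval_neq0 kl n0kl.
have lt_jl : lo j < lo l by apply: lo_mono; lia.
have lt_ik : hi i < hi k by apply: hi_mono; lia.
have lt_kn : hi k < n by apply: hi_lt; lia.
split; apply/subsetPn.
  have [x wx] : exists x, w x = lo j by apply: w_surj; lia.
  by exists x; rewrite mem_facetI_interval // wx; lia.
have [x wx] : exists x, w x = hi k by apply: w_surj; lia.
by exists x; rewrite mem_facetI_interval // wx; lia.
Qed.

(** Two intervals are glued: [lo (i + d + 1) <= hi i], given by the nonempty intersection, leaves no
    gap between them. *)
Lemma interval_closed_condC : closed_condC s.
Proof.
move=> i d lt_i d_gt0 n0.
have lt_s : i + d + 1 < size s.
  rewrite ltnNge; apply/negP => le_s; apply: n0.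
  by rewrite /facetI [nth _ _ (_ + 1)]nth_default // setI0.
have le := facetI_interval_neq0 (_ : i <= i + d + 1 < size s) n0.
have lt_lo : lo (i + d) < lo (i + d + 1) by apply: lo_mono; lia.
have lt_hi : hi i < hi (i + 1) by apply: hi_mono; lia.
apply/setP => x; rewrite in_setU !mem_facetI_interval; lia.
Qed.

Lemma interval_closed_complex : closed_complex D.
Proof.
exists s; split; [split=> // | |].
- exact: interval_leaf.
- move=> i lt_i B; split; first exact: interval_branch_unique.
  by move=> ->; apply: interval_branch.
- exact: interval_closed_condI.
- exact: interval_closed_condC.
Qed.

End IntervalFacets.

(** * From closed graphs to closed complexes *)

Section CliqueComplex.

Variables (T : finType) (e : rel T).
Hypotheses (e_sym : symmetric e).

Lemma cliqueP (A : {set T}) :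
  reflect {in A &, forall u v, u != v -> e u v} (clique e A).
Proof.
apply: (iffP forall_inP) => cl_A u.
  by move=> v Au Av; have /forall_inP/(_ v Av)/implyP := cl_A u Au.
by move=> Au; apply/forall_inP => v Av; apply/implyP/cl_A.
Qed.

Lemma mem_clique_complex (A : {set T}) : (A \in clique_complex e) = clique e A.
Proof. by rewrite inE. Qed.

Lemma facet_clique F u v : F \in facets (clique_complex e) ->
  u \in F -> v \in F -> u != v -> e u v.
Proof.
by case/facetsP; rewrite mem_clique_complex => /cliqueP cl_F _; apply: cl_F.
Qed.

(** Otherwise [x |: F] would be a larger clique. *)
Lemma facet_mem F x : F \in facets (clique_complex e) ->
  {in F, forall y, y != x -> e x y} -> x \in F.
Proof.
move=> fF adj_x; have [clF max_F] := facetsP _ _ fF.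
rewrite -(max_F (x |: F)) ?setU11 ?subsetU1 // mem_clique_complex.
apply/cliqueP => u v; rewrite !inE => /predU1P[->|Fu] /predU1P[->|Fv] ne_uv.
- by rewrite eqxx in ne_uv.
- by rewrite adj_x // eq_sym.
- by rewrite e_sym adj_x.
- exact: facet_clique fF Fu Fv ne_uv.
Qed.

Lemma clique_sub_facet A : clique e A ->
  exists2 F, F \in facets (clique_complex e) & A \subset F.
Proof.
move=> clA; have [F max_F sAF] := @maxset_exists _
  (fun A : {set T} => A \in clique_complex e) A (etrans (mem_clique_complex A) clA).
by exists F; rewrite ?inE.
Qed.

Lemma edge_in_facet u v : e u v ->
  exists F, [/\ F \in facets (clique_complex e), u \in F & v \in F].
Proof.
move=> e_uv; have [|F fF sF] := @clique_sub_facet [set u; v].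
  apply/cliqueP => x y; rewrite !inE => /orP[]/eqP-> /orP[]/eqP-> //;
    by rewrite ?eqxx // e_sym.
by exists F; split=> //; apply: (subsetP sF); rewrite !inE eqxx ?orbT.
Qed.

Lemma facet_neq0 F (x : T) : F \in facets (clique_complex e) -> F != set0.
Proof.
move=> fF; apply: contraTneq (fF) => F0; apply/negP => _.
have : x \in F by apply: facet_mem => // y; rewrite F0 inE.
by rewrite F0 inE.
Qed.

End CliqueComplex.

(** * Clique facets of a closed graph as label intervals *)

Section ClosedGraphComplex.

Variables (n : nat) (e : rel 'I_n) (w : 'I_n -> 'I_n).
Hypotheses (e_sym : symmetric e) (e_irr : irreflexive e).
Hypothesis e_conn : graph_connected e.
Hypotheses (w_bij : bijective w) (w_closed : closed_wrt e w).

Implicit Types (F H : {set 'I_n}).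
Local Notation D := (clique_complex e).
Local Notation w_inj := (label_inj w_bij).

Let convex := edge_convex e_sym e_irr e_conn.2 w_bij w_closed.
Let consecutive := edge_consecutive e_sym e_irr e_conn.2 w_bij w_closed.

Let max_label (F : {set 'I_n}) : nat := \max_(x in F) w x.
(** The minimum is the complement of a maximum, so that both endpoints go through [\max]. *)
Let min_label (F : {set 'I_n}) : nat := n - \max_(x in F) (n - w x).

Let facet_card F : F \in facets D -> 0 < #|F|.
Proof.
move=> fF; have /card_gt0P[x _] := e_conn.1.
by rewrite card_gt0 (facet_neq0 e_sym x).
Qed.

Let le_max_label F x : x \in F -> w x <= max_label F.
Proof. move=> Fx; exact: (@leq_bigmax_cond _ (mem F) (fun x => w x : nat)). Qed.

Let le_min_label F x : x \in F -> min_label F <= w x.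
Proof.
move=> Fx; rewrite /min_label.
have le_x : n - w x <= \max_(y in F) (n - w y).
  exact: (@leq_bigmax_cond _ (mem F) (fun y => n - w y)).
by have := ltn_ord (w x); lia.
Qed.

Let max_labelP F : F \in facets D -> exists2 x, x \in F & w x = max_label F :> nat.
Proof.
move=> /facet_card F_gt0.
by have [x Fx eq_x] := eq_bigmax_cond (fun x => w x : nat) F_gt0; exists x.
Qed.

Let min_labelP F : F \in facets D -> exists2 x, x \in F & w x = min_label F :> nat.
Proof.
move=> /facet_card F_gt0.
have [x Fx eq_x] := eq_bigmax_cond (fun x => n - w x) F_gt0; exists x => //.
rewrite /min_label eq_x subKn //; exact/ltnW/ltn_ord.
Qed.

(** The members [a], [b] with extreme labels are adjacent if distinct; by convexity [x] is then
    adjacent to every other member, and maximality applies. *)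
Lemma mem_facet_interval F x : F \in facets D ->
  (x \in F) = (min_label F <= w x <= max_label F).
Proof.
move=> fF; apply/idP/andP => [Fx|[le_x ge_x]].
  by split; [apply: le_min_label | apply: le_max_label].
have [[a Fa eq_a] [b Fb eq_b]] := (min_labelP fF, max_labelP fF).
apply: (facet_mem e_sym fF) => y Fy ne_yx.
have ab_edge : w a < w b -> e a b.
  move=> lt_ab; apply: (facet_clique fF Fa Fb).
  by apply: contraTneq lt_ab => ->; rewrite ltnn.
have : w x != w y :> nat by apply: contraNneq ne_yx => /w_inj ->.
have := le_min_label Fy; have := le_max_label Fy.
rewrite neq_ltn -eq_a -eq_b => le_yb le_ay /orP[] lt.
  by apply: (convex (ab_edge _)); lia.
by rewrite e_sym; apply: (convex (ab_edge _)); lia.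
Qed.

Lemma facet_labels_sub F H : F \in facets D -> H \in facets D ->
  min_label H <= min_label F -> max_label F <= max_label H -> F = H.
Proof.
move=> fF fH le_min le_max; apply: (facets_antichain fF fH); apply/subsetP => x.
rewrite !mem_facet_interval //; lia.
Qed.

(** No facet interval contains another, so sorting by least label makes both endpoints strictly
    increasing. *)
Lemma closed_graph_closed_complex : closed_complex D.
Proof.
pose s := sort (fun F H => min_label F <= min_label H) (enum (facets D)).
have s_uniq : uniq s by rewrite sort_uniq enum_uniq.
have eq_s : s =i facets D by move=> F; rewrite mem_sort mem_enum.
have facet_s i : i < size s -> nth set0 s i \in facets D.
  by move=> lt_i; rewrite -eq_s mem_nth.
have min_leq i j : i < j < size s ->
    min_label (nth set0 s i) <= min_label (nth set0 s j).
  have sorted_s := @sort_sorted _ (fun F H => min_label F <= min_label H)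
    (fun F H => leq_total _ _) (enum (facets D)).
  case/andP=> lt_ij lt_j; apply: (sorted_ltn_nth _ set0 sorted_s) => //.
  - by move=> F H G; apply: leq_trans.
  - by rewrite inE (ltn_trans lt_ij).
have neq_s i j : i < j < size s -> nth set0 s i <> nth set0 s j.
  case/andP=> lt_ij lt_j /eqP; rewrite nth_uniq //; last exact: ltn_trans lt_j.
  by move/eqP; lia.
have min_lt i j : i < j < size s ->
    min_label (nth set0 s i) < min_label (nth set0 s j).
  move=> ij; have [fi fj] : nth set0 s i \in facets D /\ nth set0 s j \in facets D.
    by split; apply: facet_s; lia.
  rewrite ltnNge; apply/negP => le_ji; apply: (neq_s _ _ ij).
  have := min_leq _ _ ij.
  have [le_max|/ltnW le_max] :=
    leqP (max_label (nth set0 s i)) (max_label (nth set0 s j)).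
    by move=> _; apply: facet_labels_sub.
  by move=> le_ij; apply/esym/facet_labels_sub.
have max_lt i j : i < j < size s ->
    max_label (nth set0 s i) < max_label (nth set0 s j).
  move=> ij; have [fi fj] : nth set0 s i \in facets D /\ nth set0 s j \in facets D.
    by split; apply: facet_s; lia.
  rewrite ltnNge; apply/negP => le_ji; apply: (neq_s _ _ ij).
  exact/esym/facet_labels_sub/le_ji/min_leq.
have w_surj := label_surj w_bij.
have max_ltn i : i < size s -> max_label (nth set0 s i) < n.
  by move=> /facet_s/max_labelP[x _ <-].
apply: (@interval_closed_complex _ _ s n (fun x => w x)
  (fun i => min_label (nth set0 s i)) (fun i => max_label (nth set0 s i))) => //.
- by move=> i lt_i x; apply/mem_facet_interval/facet_s.
(* Otherwise the edge between the labels [max F_i] and [max F_i + 1] lies in no facet. *)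
move=> i lt_i /=; rewrite leqNgt; apply/negP => lt_max_min.
have lt_i' : i < size s by apply: ltnW.
have [u _ wu] := max_labelP (facet_s _ lt_i').
have [v wv] : exists v, w v = (w u).+1 :> nat.
  apply: w_surj; rewrite wu (leq_ltn_trans lt_max_min) //.
  by have [x _ <-] := min_labelP (facet_s _ lt_i).
have [F [fF Fu Fv]] := edge_in_facet e_sym (consecutive wv).
move: fF Fu Fv; rewrite -eq_s => /(nthP set0)[k lt_k <-].
rewrite !mem_facet_interval ?facet_s // wv wu.
move=> /andP[Fu _] /andP[_ Fv].
(* The facet [k] holding the edge starts too late if [i < k] and ends too early if [k <= i]. *)
have [|le_ki] := ltnP i k.
  rewrite leq_eqVlt => /orP[/eqP eq_k|lt_ik].
    by have := leq_ltn_trans Fu lt_max_min; rewrite eq_k ltnn.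
  have := min_lt i.+1 k; rewrite lt_ik lt_k ltnNge ltnW ?(leq_ltn_trans Fu) //.
  by move=> /(_ isT).
move: Fv; rewrite ltnNge; case/negP; move: le_ki.
rewrite leq_eqVlt => /orP[/eqP-> //|lt_ki].
by apply/ltnW/max_lt; rewrite lt_ki.
Qed.

End ClosedGraphComplex.

(** * From closed complexes to closed graphs *)

(** The label is the position in the sorted list. Ties of [le] are broken arbitrarily, hence a
    single implication. *)
Lemma sort_labelling n (le : rel 'I_n) : total le -> transitive le ->
  exists2 w : 'I_n -> 'I_n, bijective w & forall u v, w u < w v -> le u v.
Proof.
move=> le_total le_trans; pose s := sort le (enum 'I_n).
have mem_s u : u \in s by rewrite mem_sort mem_enum.
have idx_lt u : index u s < n.
  by have := mem_s u; rewrite -index_mem size_sort size_enum_ord.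
exists (fun u => Ordinal (idx_lt u)) => [|u v]; last first.
  by apply: (sorted_ltn_index le_trans) => //; apply: sort_sorted.
apply: injF_bij => u v [/(congr1 (nth u s))].
by rewrite !nth_index.
Qed.

(** * Index intervals of vertices in a leaf order *)

Section LeafOrder.

Variables (T : finType) (D : {set {set T}}) (s : seq {set T}).
Hypothesis leaf_s : leaf_order D s.

(** Going up from [i]: each facet has the next one as a branch, which therefore contains its
    intersection with the [k]-th facet. *)
Lemma leaf_order_convex (x : T) i j k : i <= j <= k -> k < size s ->
  x \in nth set0 s i -> x \in nth set0 s k -> x \in nth set0 s j.
Proof.
case: leaf_s => s_uniq eq_s _ br_s.
case/andP=> /subnKC <-; elim: (j - i) => [|d IHd]; first by rewrite addn0.
rewrite addnS => lt_dk lt_k xi xk; move: (IHd (ltnW lt_dk) lt_k xi xk).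
set a := i + d in lt_dk * => xa.
have /br_s/(_ (nth set0 s a.+1))[_ /(_ erefl)] : a.+1 < size s by lia.
case/and3P=> _ _ /forall_inP/(_ (nth set0 s k)).
rewrite (facets_drop _ eq_s) mem_drop_nth; last by lia.
have -> : nth set0 s k != nth set0 s a.
  by rewrite nth_uniq ?(ltn_trans lt_dk) // neq_ltn lt_dk orbT.
by move=> /(_ isT)/subsetP/(_ x); rewrite !inE xk xa => /(_ isT)/andP[].
Qed.

Hypothesis condC_s : closed_condC s.
Hypothesis cover_s : forall x, exists2 F, F \in s & x \in F.

(** The ends of the set of indices of facets containing [x]; [cover_s] ensures that this set is
    nonempty, so no default value occurs. *)
Definition first_facet (x : T) := find (fun F : {set T} => x \in F) s.
Definition last_facet (x : T) := \max_(i < size s | x \in nth set0 s i) i.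

Lemma mem_leaf_order x i : i < size s ->
  (x \in nth set0 s i) = (first_facet x <= i <= last_facet x).
Proof.
move=> lt_i; have has_x : has (fun F : {set T} => x \in F) s.
  by have [F sF Fx] := cover_s x; apply/hasP; exists F.
apply/idP/andP => [xi|[le_i ge_i]].
  split; last exact: (@leq_bigmax_cond _ _ (fun i : 'I__ => i : nat) (Ordinal lt_i)).
  rewrite leqNgt; apply/negP => /(before_find set0).
  by rewrite xi.
have lt_f : first_facet x < size s by rewrite -has_find.
have card_gt0 : 0 < #|[pred i : 'I_(size s) | x \in nth set0 s i]|.
  by apply/card_gt0P; exists (Ordinal lt_f); rewrite inE; exact: (nth_find set0 has_x).
have [j xj eq_j] := eq_bigmax_cond (fun i : 'I__ => i : nat) card_gt0.
apply: (@leaf_order_convex x (first_facet x) i j) => //.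
  by rewrite le_i -eq_j.
exact: (nth_find set0 has_x).
Qed.

Lemma first_facet_lt x : first_facet x < size s.
Proof.
by have [F sF Fx] := cover_s x; rewrite -has_find; apply/hasP; exists F.
Qed.

Lemma last_facet_lt x : last_facet x < size s.
Proof.
have lt_f := first_facet_lt x; apply: leq_ltn_trans (_ : (size s).-1 < _); last by lia.
by apply/bigmax_leqP => i _; have := ltn_ord i; lia.
Qed.

Lemma first_le_last x : first_facet x <= last_facet x.
Proof.
have lt_f := first_facet_lt x; have has_x := lt_f; rewrite -has_find in has_x.
by have := mem_leaf_order x lt_f; rewrite leqnn /= => <-; exact: (nth_find set0 has_x).
Qed.

(* Condition (C) with i + 1 = first y and i + d = last y. *)
Lemma facet_intervals_not_nested x y :
  first_facet x < first_facet y -> last_facet x <= last_facet y.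
Proof.
move=> lt_f; rewrite leqNgt; apply/negP => lt_l.
have := (first_facet_lt y, last_facet_lt x, first_le_last y); case=> [[ltfy ltlx] fly].
pose i := (first_facet y).-1; pose d := (last_facet y - first_facet y).+1.
have [eq_i1 eq_d eq_d1] : [/\ i + 1 = first_facet y, i + d = last_facet y
  & i + d + 1 = (last_facet y).+1] by rewrite /i /d; split; lia.
have := @condC_s i d; rewrite eq_d1 eq_i1 eq_d => eqC.
(* [x] lies in [F_{i,i+d+1}], so (C) applies. But [y] lies only in its left side, being in neither
   facet [i] nor facet [i + d + 1]. *)
have : y \in facetI s (first_facet y) (last_facet y).
  by rewrite inE !mem_leaf_order ?last_facet_lt //; lia.
rewrite eqC //; last 2 first.
- by rewrite /i; lia.
- apply/eqP/set0Pn; exists x; rewrite inE !mem_leaf_order; rewrite /i; lia.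
by rewrite !inE !mem_leaf_order; rewrite /i; lia.
Qed.

End LeafOrder.

Lemma closed_complex_closed_graph n (e : rel 'I_n) : symmetric e ->
  closed_complex (clique_complex e) -> closed_graph e.
Proof.
move=> e_sym [s [leaf_s _ condC_s]]; have [_ eq_s _ _] := leaf_s.
have cover_s x : exists2 F, F \in s & x \in F.
  have [|F fF sF] := @clique_sub_facet _ e [set x].
    by apply/cliqueP => y z; rewrite !inE => /eqP-> /eqP->; rewrite eqxx.
  by exists F; rewrite ?eq_s // (subsetP sF) // inE.
pose l := first_facet s; pose r := last_facet s.
have not_nested x y : l x < l y -> r x <= r y.
  exact: (facet_intervals_not_nested leaf_s).
have le_lr x : l x <= r x by exact: (first_le_last leaf_s cover_s).
have mem_s x i : i < size s -> (x \in nth set0 s i) = (l x <= i <= r x).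
  exact: (mem_leaf_order leaf_s cover_s).
have lt_l x : l x < size s := first_facet_lt cover_s x.
have lt_r x : r x < size s := last_facet_lt cover_s x.
(* As index intervals are not nested, comparing the sums of endpoints compares both endpoints. *)
have [w w_bij w_mono] := @sort_labelling n (fun x y => l x + r x <= l y + r y)
  (fun _ _ => leq_total _ _) (fun _ _ _ => @leq_trans _ _ _).
have mono x y : w x < w y -> (l x <= l y) && (r x <= r y).
  by move/w_mono; have := not_nested x y; have := not_nested y x; lia.
exists w => // u v v' e_uv e_uv' ne_vv' lt_w.
have common x y : e x y -> exists2 i, i < size s & (l x <= i <= r x) && (l y <= i <= r y).
  move=> /(edge_in_facet e_sym)[F [+ Fx Fy]]; rewrite -eq_s => /(nthP set0)[i lt_i eq_F].
  by exists i => //; rewrite -!mem_s // eq_F Fx.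
have [[i lt_i meet_i] [j lt_j meet_j]] := (common _ _ e_uv, common _ _ e_uv').
have adj k : k < size s -> l v <= k <= r v -> l v' <= k <= r v' -> e v v'.
  move=> lt_k vk v'k; apply: (@facet_clique _ _ (nth set0 s k)); rewrite ?mem_s //.
  by rewrite -eq_s mem_nth.
(* If [v], [v'] come after [u], both start by [r u] and end no earlier, so both contain the larger
   start; the other case is symmetric. *)
case/orP: lt_w => /andP[/mono uv /mono uv'].
  by apply: (adj (maxn (l v) (l v'))); rewrite ?gtn_max ?lt_l //; lia.
by apply: (adj (minn (r v) (r v'))); rewrite ?gtn_min ?lt_r //; lia.
Qed.

(** * Binomial edge ideals *)

Section IdealGen.

Import GRing.Theory.
Local Open Scope ring_scope.

Variable R : comNzRingType.
Implicit Types (P Q : R -> Prop).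

Lemma ideal_gen_gen P p : P p -> ideal_gen P p.
Proof.
move=> Pp; exists [:: (1, p)]; last by rewrite big_seq1 mul1r.
by move=> c; rewrite inE => /eqP->.
Qed.

Lemma ideal_genD P p q : ideal_gen P p -> ideal_gen P q -> ideal_gen P (p + q).
Proof.
move=> [s Ps ->] [r Pr ->]; exists (s ++ r); last by rewrite big_cat.
by move=> c; rewrite mem_cat => /orP[/Ps|/Pr].
Qed.

Lemma ideal_genM P a p : ideal_gen P p -> ideal_gen P (a * p).
Proof.
move=> [s Ps ->]; exists [seq (a * c.1, c.2) | c <- s].
  by move=> _ /mapP[c sc ->]; apply: (Ps c).
by rewrite big_map mulr_sumr; apply: eq_bigr => c _; rewrite mulrA.
Qed.

Lemma ideal_gen_sub P Q p :
  (forall q, P q -> ideal_gen Q q) -> ideal_gen P p -> ideal_gen Q p.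
Proof.
move=> sPQ [s Ps ->]; elim: s Ps => [_|c s IHs Ps].
  by rewrite big_nil; exists [::] => //; rewrite big_nil.
rewrite big_cons; apply: ideal_genD.
  by apply/ideal_genM/sPQ/Ps/mem_head.
by apply: IHs => d sd; apply: Ps; rewrite inE sd orbT.
Qed.

End IdealGen.

(** * Coefficient sums and leading monomials *)

Section Monomials.

Import GRing.Theory.
Local Open Scope ring_scope.

Variables (N : nat) (K : fieldType).
Implicit Types (p q : {mpoly K[N]}) (A : pred 'X_{1..N}).

(** A linear form; it vanishes on [J_G] when [A] is stable under exchanges along edges. *)
Definition coeff_sum A p := \sum_(m <- msupp p | A m) p@_m.

Lemma coeff_sum_widen A p (r : seq 'X_{1..N}) : uniq r ->
  {subset msupp p <= r} -> coeff_sum A p = \sum_(m <- r | A m) p@_m.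
Proof.
move=> r_uniq s_pr; rewrite (bigID (fun m => m \in msupp p)) /= [X in _ + X]big1.
  rewrite addr0; under eq_bigl do rewrite andbC.
  rewrite -big_filter_cond; apply: perm_big; apply: uniq_perm.
  - exact: msupp_uniq.
  - by rewrite filter_uniq.
  by move=> m; rewrite mem_filter; case: (boolP (m \in _)) => // /s_pr->.
by move=> m /andP[_]; apply: memN_msupp_eq0.
Qed.

Lemma coeff_sumD A : {morph coeff_sum A : p q / p + q}.
Proof.
move=> p q; pose r := undup (msupp p ++ msupp q).
have widen := @coeff_sum_widen A _ r (undup_uniq _).
rewrite !widen => [|m qm|m pm|m /msuppD_le]; rewrite ?mem_undup ?mem_cat ?pm ?qm ?orbT //.
by rewrite -big_split /=; apply: eq_bigr => m _; rewrite mcoeffD.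
Qed.

Lemma coeff_sum0 A : coeff_sum A 0 = 0.
Proof. by rewrite /coeff_sum msupp0 big_nil. Qed.

Lemma coeff_sumX A c m : coeff_sum A (c *: 'X_[m]) = c *+ A m.
Proof.
rewrite (@coeff_sum_widen A _ [:: m]) //; last by move=> m' /msuppZ_le; rewrite msuppX.
by rewrite big_cons big_nil mcoeffZ mcoeffX eqxx mulr1 addr0; case: (A m).
Qed.

Lemma coeff_sum_eq0_pred1 A p m : A m ->
  {in msupp p, forall m', A m' -> m' = m} -> coeff_sum A p = p@_m.
Proof.
move=> Am uniq_m; rewrite (@coeff_sum_widen A p (undup (m :: msupp p))).
- rewrite big_mkcond (bigD1_seq m) ?undup_uniq ?mem_undup ?mem_head //= Am.
  rewrite big1 ?addr0 // => m' ne_m; case: ifP => // Am'; apply: memN_msupp_eq0.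
  apply: contraNN ne_m => pm'.
  by rewrite (uniq_m m').
- exact: undup_uniq.
- by move=> m' pm'; rewrite mem_undup inE pm' orbT.
Qed.

Lemma mem_msupp_diffX (a b m : 'X_{1..N}) :
  m \in msupp ('X_[a] - 'X_[b] : {mpoly K[N]}) -> (m == a) || (m == b).
Proof. by move/msuppB_le; rewrite mem_cat !msuppX !inE. Qed.

Lemma is_lead_diffX (le : rel 'X_{1..N}) (a b : 'X_{1..N}) :
  reflexive le -> le b a -> a != b ->
  is_lead le ('X_[a] - 'X_[b] : {mpoly K[N]}) a.
Proof.
move=> le_refl le_ba ne_ab; split.
  rewrite mcoeff_msupp mcoeffB !mcoeffX eqxx [b == a]eq_sym (negbTE ne_ab) subr0.
  exact: oner_neq0.
by move=> m /mem_msupp_diffX/orP[]/eqP->.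
Qed.

(** Some term [c.1 * c.2] of the combination must contain the monomial [m], and its support consists
    of multiples of one leading monomial. *)
Lemma lead_idealX (le : rel 'X_{1..N}) (P : {mpoly K[N]} -> Prop) m :
  lead_ideal le P 'X_[m] ->
  exists p m', [/\ P p, is_lead le p m' & (m' <= m)%MM].
Proof.
case=> s gen_s eq_m.
have : has (fun c : {mpoly K[N]} * {mpoly K[N]} => (c.1 * c.2)@_m != 0) s.
  apply: contraT; rewrite -all_predC => /allP zero_s.
  have /eqP : ('X_[m] : {mpoly K[N]})@_m = 0.
    rewrite eq_m raddf_sum /= big_seq big1 // => c /zero_s /=.
    by rewrite negbK => /eqP.
  by rewrite mcoeffX eqxx oner_eq0.
case/hasP=> c /gen_s[p [m' [Pp lead_m' ->]]].
rewrite -mcoeff_msupp (perm_mem (msuppMX _ _)) => /mapP[k _ ->].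
by exists p, m'; split=> //; apply: lem_addr.
Qed.

(** Reduces inclusion of leading ideals to divisibility between leading monomials. *)
Lemma lead_ideal_sub (le : rel 'X_{1..N}) (P Q : {mpoly K[N]} -> Prop) q :
  (forall p m, P p -> is_lead le p m ->
     exists p' m', [/\ Q p', is_lead le p' m' & (m' <= m)%MM]) ->
  lead_ideal le P q -> lead_ideal le Q q.
Proof.
move=> sPQ; apply: ideal_gen_sub => _ [p [m [Pp lead_m ->]]].
have [p' [m' [Qp' lead_m' le_m]]] := sPQ p m Pp lead_m.
rewrite -(submK le_m) mpolyXD; apply: ideal_genM.
by apply: ideal_gen_gen; exists p', m'.
Qed.

End Monomials.

(** * Exchanges along edges and the support of elements of [J_G] *)

Section BinomialEdgeIdeal.

Import GRing.Theory.
Local Open Scope ring_scope.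

Variables (n : nat) (e : rel 'I_n) (K : fieldType).
Hypotheses (e_sym : symmetric e) (e_irr : irreflexive e).

(* The exponent vector of x_i y_j. *)
Definition xy (i j : 'I_n) : 'X_{1..n + n} := (U_(lshift n i) + U_(rshift n j))%MM.

Lemma binom_edgeE i j : binom_edge K i j = 'X_[xy i j] - 'X_[xy j i].
Proof. by rewrite /binom_edge /xy !mpolyXD. Qed.

Lemma xy_lshift i j v : xy i j (lshift n v) = (i == v).
Proof. by rewrite mnmDE !mnm1E eq_lshift eq_rlshift addn0. Qed.

Lemma xy_rshift i j v : xy i j (rshift n v) = (j == v).
Proof. by rewrite mnmDE !mnm1E eq_rshift eq_lrshift add0n. Qed.

Lemma mdeg_xy i j : mdeg (xy i j) = 2.
Proof. by rewrite mdegD !mdeg1. Qed.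

Lemma xy_inj i j i' j' : xy i j = xy i' j' -> i = i' /\ j = j'.
Proof.
move/mnmP=> eq_xy; have := eq_xy (lshift n i'); have := eq_xy (rshift n j').
rewrite !xy_lshift !xy_rshift !eqxx.
by case: (eqVneq i i') => // ->; case: (eqVneq j j').
Qed.

Lemma binom_edge_ideal i j : e i j -> binomial_edge_ideal K e (binom_edge K i j).
Proof.
move=> e_ij; have [lt_ij|lt_ji|/val_inj eq_ij] := ltngtP i j.
- by apply: ideal_gen_gen; exists i, j.
- have -> : binom_edge K i j = (-1) * binom_edge K j i.
    by rewrite !binom_edgeE mulN1r opprB.
  by apply/ideal_genM/ideal_gen_gen; exists j, i; rewrite e_sym.
- by rewrite eq_ij e_irr in e_ij.
Qed.

(** [J_G] is spanned by the monomial multiples of edge binomials, whose two monomials are both in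
    [A] or both outside. *)
Lemma coeff_sum_edge_ideal (A : pred 'X_{1..n + n}) p :
  (forall h i j, e i j -> A (h + xy i j)%MM = A (h + xy j i)%MM) ->
  binomial_edge_ideal K e p -> coeff_sum A p = 0.
Proof.
move=> invA [s gen_s ->].
rewrite (big_morph _ (coeff_sumD A) (coeff_sum0 K A)) big_seq big1 // => -[a f].
case/gen_s=> i [j [_ e_ij /= ->]]; rewrite (mpolyE a) mulr_suml.
rewrite (big_morph _ (coeff_sumD A) (coeff_sum0 K A)) big1 // => m _.
rewrite binom_edgeE -scalerAl mulrBr -!mpolyXD scalerBr coeff_sumD -scaleNr.
by rewrite !coeff_sumX invA // mulNrn subrr.
Qed.

(** In degree 2 the stable set is [{x_i y_j, x_j y_i}] for an edge, so both monomials occur or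
    neither does. Any other quadratic monomial is a stable set alone, so its coefficient is 0. *)
Lemma edge_ideal_quadratic_support p m : binomial_edge_ideal K e p ->
  m \in msupp p -> mdeg m = 2 ->
  exists i j, [/\ e i j, m = xy i j & xy j i \in msupp p].
Proof.
move=> Jp pm deg_m.
have quadratic h a b i j : (h + xy a b)%MM = xy i j -> [/\ h = 0%MM, a = i & b = j].
  move=> eq_h; have h0 : h = 0%MM.
    apply/eqP; rewrite -mdeg_eq0; have := congr1 mdeg eq_h.
    by rewrite mdegD !mdeg_xy; lia.
  by move: eq_h; rewrite h0 add0m => /xy_inj[].
have [/existsP[i /existsP[j /andP[e_ij /eqP eq_m]]]|no_edge] :=
    boolP [exists i, exists j, e i j && (m == xy i j)].
  exists i, j; split=> //; apply: contraTT pm => pNm.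
  rewrite mcoeff_msupp negbK eq_m; apply/eqP.
  rewrite -(@coeff_sum_eq0_pred1 _ _ (pred2 (xy i j) (xy j i))) /= ?eqxx //.
    apply: coeff_sum_edge_ideal Jp => h a b _ /=.
    by apply/idP/idP => /pred2P[]/quadratic[-> -> ->]; rewrite add0m eqxx ?orbT.
  by move=> m' pm' /orP[]/eqP // eq_m'; rewrite -eq_m' pm' in pNm.
have := pm; rewrite mcoeff_msupp -(@coeff_sum_eq0_pred1 _ _ (pred1 m)) /= ?eqxx //;
  last by move=> m' _ /eqP.
rewrite coeff_sum_edge_ideal ?eqxx // => h.
have not_m a b : e a b -> ((h + xy a b)%MM == m) = false.
  move=> e_ab; apply: contraNF no_edge => /eqP eq_m.
  apply/existsP; exists a; apply/existsP; exists b; rewrite e_ab -eq_m.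
  have -> : h = 0%MM; last by rewrite add0m eqxx.
  by apply/eqP; rewrite -mdeg_eq0; move: deg_m; rewrite -eq_m mdegD mdeg_xy; lia.
by move=> a b e_ab /=; rewrite !not_m // e_sym.
Qed.

End BinomialEdgeIdeal.

(** * From quadratic Groebner bases to closed graphs *)

Section ClosedFromGroebner.

Import GRing.Theory.
Local Open Scope ring_scope.

Variables (n : nat) (e : rel 'I_n) (K : fieldType).
Hypotheses (e_sym : symmetric e) (e_irr : irreflexive e).

Lemma term_order_cancel N (le : rel 'X_{1..N}) m1 m2 m :
  term_order le -> le (m1 + m)%MM (m2 + m)%MM -> le m1 m2.
Proof.
case=> [[le_refl le_anti] _ le_total _ le_add] le_12.
have /orP[//|le_21] := le_total m1 m2.
have /eqP : (m1 + m)%MM = (m2 + m)%MM by apply: le_anti; rewrite le_12 le_add.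
by rewrite eqm_add2r => /eqP->.
Qed.

Lemma quadratic_groebner_closed (le : rel 'X_{1..n + n}) (g : seq {mpoly K[n + n]}) :
  term_order le -> quadratic_groebner_basis le (binomial_edge_ideal K e) g ->
  closed_graph e.
Proof.
move=> le_order [[gJ lead_g] g_homog].
have [[le_refl le_anti] le_trans le_total _ le_add] := le_order.
(* After multiplication by [x_v y_v], the product [x_t y_u x_v y_v] regroups as
   [(x_t y_v)(x_v y_u)], to which both hypotheses apply; then cancel. *)
have prec_trans : transitive (fun u v => le (xy v u) (xy u v)).
  move=> v u t le_uv le_vt; apply: (@term_order_cancel _ _ _ _ (xy v v)) => //.
  have -> : (xy t u + xy v v = xy t v + xy v u)%MM.
    by apply/mnmP => i; rewrite !mnmE; lia.
  have -> : (xy u t + xy v v = xy u v + xy v t)%MM.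
    by apply/mnmP => i; rewrite !mnmE; lia.
  apply: (le_trans (xy v t + xy v u)%MM); first exact: le_add.
  by rewrite addmC le_add.
have [w w_bij w_mono] := @sort_labelling n (fun u v => le (xy v u) (xy u v))
  (fun u v => le_total _ _) prec_trans.
have w_anti u v : (w u < w v)%N -> ~ le (xy u v) (xy v u).
  move=> lt_uv le_uv; have /xy_inj[eq_uv _] : xy u v = xy v u.
    by apply: le_anti; rewrite le_uv w_mono.
  by rewrite eq_uv ltnn in lt_uv.
(* The S-polynomials of f_{uv} and f_{uv'} are [t * f_{vv'}] with t = y_u, x_u. *)
have lead_multiple t v v' : (w v < w v')%N ->
    binomial_edge_ideal K e ('X_t * binom_edge K v v') ->
    exists i j, [/\ e i j, (w i < w j)%N & (xy i j <= U_(t) + xy v v')%MM].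
  move=> lt_vv' Jq.
  have [] := @lead_idealX _ K le (fun p => p \in g) (U_(t) + xy v v')%MM.
    apply/lead_g/ideal_gen_gen; exists ('X_t * binom_edge K v v'), (U_(t) + xy v v')%MM.
    split=> //; rewrite binom_edgeE mulrBr -!mpolyXD; apply: is_lead_diffX => //.
      by rewrite addmC [X in le _ X]addmC le_add // w_mono.
    by rewrite eqm_add2l; apply: contraTneq lt_vv' => /xy_inj[-> _]; rewrite ltnn.
  move=> p [m [gp [pm lead_m] le_m]].
  have deg_m := dhomog_mf (g_homog p gp) pm.
  (* The exchanged monomial [x_j y_i] also occurs in [p]; since [x_i y_j] leads, [w i < w j]. *)
  have [i [j [e_ij eq_m pji]]] := edge_ideal_quadratic_support e_sym (gJ p gp).1 pm deg_m.
  exists i, j; split; rewrite -?eq_m //.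
  have le_ij := lead_m _ pji; rewrite eq_m in le_ij.
  have [//|/w_anti//|/val_inj/(bij_inj w_bij) eq_ij] := ltngtP (w i) (w j).
  by rewrite eq_ij e_irr in e_ij.
have closed_lt u v v' : e u v -> e u v' -> (w v < w v')%N ->
    (w u < w v)%N && (w u < w v')%N || (w v < w u)%N && (w v' < w u)%N -> e v v'.
  move=> e_uv e_uv' lt_vv' /orP[]/andP[lt_v lt_v'].
    have [|i [j [e_ij lt_ij /mnm_lepP le_xy]]] := @lead_multiple (rshift n u) v v' lt_vv'.
      have -> : 'X_(rshift n u) * binom_edge K v v' =
          'X_(rshift n v) * binom_edge K u v' + (- 'X_(rshift n v')) * binom_edge K u v.
        rewrite /binom_edge; ring.
      by apply: ideal_genD; apply: ideal_genM; apply: binom_edge_ideal.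
    (* [x_i y_j] divides [y_u x_v y_{v'}], so [i = v] and [j] is [v'] or [u]; [j = u] would
       contradict [w u < w v]. *)
    have := le_xy (lshift n i); have := le_xy (rshift n j).
    rewrite !(mnmDE, mnm1E, eq_lshift, eq_rshift, eq_lrshift, eq_rlshift) !eqxx.
    rewrite add0n !addn0 => le_j le_i.
    have /eqP eq_i : v == i by case: (v == i) le_i.
    move: le_j; case: (eqVneq v' j) => [-> _|_]; first by rewrite eq_i.
    by case: (eqVneq u j) => // eq_j; move: lt_v; rewrite eq_j eq_i; lia.
  have [|i [j [e_ij lt_ij /mnm_lepP le_xy]]] := @lead_multiple (lshift n u) v v' lt_vv'.
    have -> : 'X_(lshift n u) * binom_edge K v v' =
        'X_(lshift n v) * binom_edge K u v' + (- 'X_(lshift n v')) * binom_edge K u v.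
      rewrite /binom_edge; ring.
    by apply: ideal_genD; apply: ideal_genM; apply: binom_edge_ideal.
  (* Here [x_i y_j] divides [x_u x_v y_{v'}], and [i = u] would contradict [w v' < w u]. *)
  have := le_xy (lshift n i); have := le_xy (rshift n j).
  rewrite !(mnmDE, mnm1E, eq_lshift, eq_rshift, eq_lrshift, eq_rlshift) !eqxx.
  rewrite !add0n !addn0 => le_j le_i.
  have /eqP eq_j : v' == j by case: (v' == j) le_j.
  move: le_i; case: (eqVneq v i) => [-> _|_]; first by rewrite eq_j.
  by case: (eqVneq u i) => // eq_i; move: lt_v'; rewrite eq_i eq_j; lia.
exists w => // u v v' e_uv e_uv' ne_vv' lt_w.
have [lt|lt|/val_inj/(bij_inj w_bij) eq] := ltngtP (w v) (w v').
- exact: closed_lt lt_w.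
- rewrite e_sym; apply: (closed_lt u) => //.
  by case/orP: lt_w => /andP[-> ->]; rewrite ?orbT.
- by rewrite eq eqxx in ne_vv'.
Qed.

End ClosedFromGroebner.

(** * From closed graphs to quadratic Groebner bases *)

Section RelabelledOrder.

Import Order.TTheory.

Variables (n : nat) (w w' : 'I_n -> 'I_n).
Hypotheses (wK : cancel w w') (wK' : cancel w' w).
Implicit Types m : 'X_{1..n + n}.

Definition relabel_var (p : 'I_(n + n)) : 'I_(n + n) :=
  match split p with
  | inl k => lshift n (w' k)
  | inr k => rshift n (w' k)
  end.

Definition relabel m : 'X_{1..n + n} :=
  [multinom m (relabel_var p) | p < n + n].

(** The graded lexicographic order with the [x] variables first, then the [y] variables, each in
    label order. *)
Definition relabelled_le : rel 'X_{1..n + n} :=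
  fun m1 m2 => (relabel m1 <= relabel m2)%O.

Lemma relabel_lshift m k : relabel m (lshift n k) = m (lshift n (w' k)).
Proof.
rewrite mnmE /relabel_var; case: split_ordP => j; first by move=> /lshift_inj ->.
by move/eqP; rewrite eq_lrshift.
Qed.

Lemma relabel_rshift m k : relabel m (rshift n k) = m (rshift n (w' k)).
Proof.
rewrite mnmE /relabel_var; case: split_ordP => j; last by move=> /rshift_inj ->.
by move/eqP; rewrite eq_rlshift.
Qed.

Lemma eq_mnm_shift m1 m2 :
  (forall v, m1 (lshift n v) = m2 (lshift n v)) ->
  (forall v, m1 (rshift n v) = m2 (rshift n v)) -> m1 = m2.
Proof. by move=> eq_l eq_r; apply/mnmP => p; case: (split_ordP p) => j ->. Qed.

Lemma relabel_inj : injective relabel.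
Proof.
move=> m1 m2 /mnmP eq_m; apply: eq_mnm_shift => v.
  by have := eq_m (lshift n (w v)); rewrite !relabel_lshift wK.
by have := eq_m (rshift n (w v)); rewrite !relabel_rshift wK.
Qed.

Lemma relabelD m1 m2 : relabel (m1 + m2) = (relabel m1 + relabel m2)%MM.
Proof. by apply/mnmP => p; rewrite !mnmE. Qed.

Lemma relabelled_term_order : term_order relabelled_le.
Proof.
split.
- split=> [m|m1 m2 /le_anti/relabel_inj //]; exact: lexx.
- move=> m2 m1 m3; exact: le_trans.
- move=> m1 m2; exact: le_total.
- by move=> m; rewrite /relabelled_le (_ : relabel 0 = 0%MM) ?le0m //;
    apply/mnmP => p; rewrite !mnmE.
- by move=> m1 m2 m; rewrite /relabelled_le !relabelD lemc_add2l.
Qed.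

Lemma mdeg_shift m :
  mdeg m = \sum_v (m (lshift n v) + m (rshift n v)).
Proof. by rewrite mdegE big_split_ord big_split. Qed.

Lemma mdeg_relabel m : mdeg (relabel m) = mdeg m.
Proof.
rewrite !mdeg_shift (reindex w) /=; last by exists w' => v _.
by apply: eq_bigr => v _; rewrite relabel_lshift relabel_rshift wK.
Qed.

(** The first variable with different exponents is an [x]: once all [x] exponents agree, equal
    vertex degrees make the [y] exponents agree. *)
Lemma relabelled_ltP m1 m2 :
  (forall v, m1 (lshift n v) + m1 (rshift n v) = m2 (lshift n v) + m2 (rshift n v)) ->
  relabelled_le m1 m2 -> m1 <> m2 ->
  exists2 v, forall u, w u < w v -> m1 (lshift n u) = m2 (lshift n u)
           & m1 (lshift n v) < m2 (lshift n v).
Proof.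
move=> eq_deg le12 ne12.
have lt12 : (relabel m1 < relabel m2)%O.
  by rewrite lt_neqAle [(_ <= _)%O]le12 andbT (inj_eq relabel_inj); apply/eqP.
have /ltmcP [|p eq_p] := lt12.
  by rewrite !mdeg_relabel !mdeg_shift; apply: eq_bigr.
have eq_l (k : 'I_n) : k < p -> m1 (lshift n (w' k)) = m2 (lshift n (w' k)).
  by move=> lt_k; rewrite -!relabel_lshift eq_p.
have [k def_p|k def_p] := split_ordP p; rewrite def_p.
  rewrite !relabel_lshift => lt_k; exists (w' k) => // u.
  by rewrite wK' => lt_u; rewrite -[u]wK eq_l // def_p.
rewrite !relabel_rshift; have := eq_l (w k); have := eq_deg (w' k).
have := eq_l k; rewrite def_p /=; have := ltn_ord k; lia.
Qed.

(** The first variable that distinguishes the two monomials is [x_u]. *)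
Lemma relabelled_lt_xy u v : w u < w v ->
  relabelled_le (xy v u) (xy u v) && (xy u v != xy v u).
Proof.
move=> lt_uv; have ne_uv : xy u v != xy v u.
  by apply: contraTneq lt_uv => /xy_inj[-> _]; rewrite ltnn.
rewrite ne_uv andbT; apply/ltW/ltmcP; first by rewrite !mdeg_relabel !mdeg_xy.
exists (lshift n (w u)) => [p lt_p|].
  have [k def_p|k def_p] := split_ordP p; last first.
    by move: lt_p; rewrite def_p /=; have := ltn_ord (w u); lia.
  rewrite def_p /= in lt_p *; rewrite !relabel_lshift !xy_lshift.
  have ne_k x : w u <= w x -> (x == w' k) = false.
    by move=> le_x; apply: contraTF lt_p => /eqP eq_x; rewrite eq_x wK' in le_x; lia.
  by rewrite !ne_k // ltnW.
rewrite !relabel_lshift !xy_lshift wK eqxx.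
by case: eqVneq lt_uv => // ->; rewrite ltnn.
Qed.

End RelabelledOrder.

(** * Standard monomials and exchange classes for a closed labelling *)

Section GroebnerFromClosed.

Import GRing.Theory.

Variables (n : nat) (e : rel 'I_n) (w w' : 'I_n -> 'I_n) (K : fieldType).
Hypotheses (e_sym : symmetric e) (e_irr : irreflexive e).
Hypotheses (wK : cancel w w') (wK' : cancel w' w).
Hypothesis convex : forall i j p q,
  e i j -> w i <= w p -> w p < w q -> w q <= w j -> e p q.
Implicit Types m h : 'X_{1..n + n}.

Local Notation le := (relabelled_le w').

Definition vdeg m v := m (lshift n v) + m (rshift n v).

Definition ydeg_below k m := \sum_(v | w v < k) m (rshift n v).

(** Across such a cut no exchange can move a [y]. *)
Definition barrier m k := [forall i, forall j,
  [&& e i j, 0 < vdeg m i & 0 < vdeg m j] ==> ((w i < k) == (w j < k))].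

(* Swaps along edges preserve the degree at each vertex, and, at each cut of the
   vertices that no edge of the support crosses, the y-degree below the cut. *)
Definition same_class m m' :=
  [forall v, vdeg m' v == vdeg m v] &&
  [forall k : 'I_n.+1, barrier m k ==> (ydeg_below k m' == ydeg_below k m)].

(** The standard monomials of the ideal generated by the [x_i y_j] with [e i j] and [w i < w j]. *)
Definition standard m := [forall i, forall j,
  [&& e i j, w i < w j & 0 < m (lshift n i)] ==> (m (rshift n j) == 0)].

Lemma vdeg_xy h i j v : vdeg (h + xy i j) v = vdeg h v + (i == v) + (j == v).
Proof. by rewrite /vdeg mnmDE xy_lshift mnmDE xy_rshift; lia. Qed.

Lemma ydeg_below_xy k h i j :
  ydeg_below k (h + xy i j) = ydeg_below k h + (w j < k).
Proof.
rewrite /ydeg_below; under eq_bigr do rewrite mnmDE xy_rshift.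
rewrite big_split /=; congr addn; case: ltnP => [lt_j|le_j].
  by rewrite (bigD1 j) //= eqxx big1 // => v /andP[_]; rewrite eq_sym => /negbTE->.
by rewrite big1 // => v lt_v; case: eqVneq => // eq_j; rewrite eq_j in le_j; lia.
Qed.

(** Both [i] and [j] occur in [m], so a barrier has them on the same side and the exchange leaves
    the [y]-degree below it unchanged. *)
Lemma same_class_swap_imp m h i j : e i j ->
  same_class m (h + xy i j) -> same_class m (h + xy j i).
Proof.
move=> e_ij /andP[/forallP deg_m /forallP bar_m].
have deg_gt0 v : (v == i) || (v == j) -> 0 < vdeg m v.
  by rewrite -(eqP (deg_m v)) vdeg_xy ![v == _]eq_sym; lia.
apply/andP; split; apply/forallP.
  by move=> v; have := deg_m v; rewrite !vdeg_xy; lia.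
move=> k; apply/implyP => bar_k; have /implyP/(_ bar_k) := bar_m k.
have /forallP/(_ i)/forallP/(_ j) := bar_k.
by rewrite e_ij !deg_gt0 ?eqxx ?orbT //= !ydeg_below_xy => /eqP->.
Qed.

Lemma same_class_swap m h i j : e i j ->
  same_class m (h + xy i j) = same_class m (h + xy j i).
Proof.
by move=> e_ij; apply/idP/idP; apply: same_class_swap_imp; rewrite // e_sym.
Qed.

Lemma same_class_refl m : same_class m m.
Proof.
by apply/andP; split; apply/forallP => k; rewrite ?eqxx ?implybT.
Qed.

(* An edge crossing the cut just above u yields either the edge uv, excluded if
   y_v occurs, or a vertex nearer to v that carries an x. *)
Lemma standard_sorted m u v k : standard m ->
  0 < m (lshift n u) -> w u < w v -> w v < k ->
  (forall l, w u < l -> l < k -> ~~ barrier m l) -> m (rshift n v) = 0.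
Proof.
move=> std_m; have [d] := ubnP (w v - w u).
elim: d u => // d IHd u lt_d xu lt_uv lt_vk no_bar.
have [//|yv_gt0] := posnP (m (rshift n v)).
have std i j : e i j -> w i < w j -> 0 < m (lshift n i) -> m (rshift n j) = 0.
  move=> e_ij lt_ij xi; have /forallP/(_ i)/forallP/(_ j)/implyP := std_m.
  by rewrite e_ij lt_ij xi => /(_ isT)/eqP.
have [i [j [e_ij deg_j le_iu lt_uj]]] :
    exists i j, [/\ e i j, 0 < vdeg m j, w i <= w u & w u < w j].
  have := no_bar (w u).+1; rewrite ltnSn (leq_ltn_trans lt_uv) // => /(_ isT isT).
  case/forallPn=> i /forallPn[j].
  rewrite negb_imply !ltnS => /andP[/and3P[e_ij deg_i deg_j]].
  case: (leqP (w i) (w u)) => le_i; case: (leqP (w j) (w u)) => le_j // _.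
    by exists i, j.
  by exists j, i; rewrite e_sym.
(* Convexity shrinks the crossing edge to [uv] if [j] is beyond [v], and to [uj] otherwise. In the
   latter case [y_j] is excluded, so [x_j] occurs and [j] replaces [u]. *)
have [le_jv|lt_vj] := leqP (w j) (w v); last first.
  by apply: (std u) => //; apply: convex e_ij _ _ _ => //; apply: ltnW.
have e_uj : e u j by apply: convex e_ij _ _ _.
have yj0 := std _ _ e_uj lt_uj xu.
move: deg_j; rewrite /vdeg yj0 addn0 => xj.
move: le_jv; rewrite leq_eqVlt => /orP[/eqP/val_inj/(can_inj wK) <- //|lt_jv].
apply: (IHd j) => //; first by lia.
by move=> l lt_jl; apply: no_bar; apply: ltn_trans lt_jl.
Qed.

(** Let [x_v] be the first variable where [m'] is smaller, and [k] the first barrier above [v].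
    Below [k], [m'] has as many [y]'s as [m] before [v], more at [v], and [m] has none after [v]:
    the [y]-degrees below [k] cannot agree. *)
Lemma standard_min m m' : standard m -> same_class m m' -> le m' m -> m' = m.
Proof.
move=> std_m /andP[/forallP deg_m /forallP bar_m] le_m.
have [//|/eqP ne_m] := eqVneq m' m.
have [v eq_lt lt_v] := relabelled_ltP wK wK' (fun v => eqP (deg_m v)) le_m ne_m.
pose P k := (w v < k) && barrier m k.
(* The cut at [n] is above every label, so a barrier beyond [v] exists. *)
have Pn : P n.
  by rewrite /P ltn_ord; apply/forallP => i; apply/forallP => j; rewrite !ltn_ord implybT.
have exP : exists k, P k by exists n.
case: (ex_minnP exP) => k /andP[lt_vk bar_k] min_k.
have ltk : k < n.+1 by apply: min_k.
have := bar_m (Ordinal ltk); rewrite /= bar_k /= => /eqP eq_y.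
have y0 u : w v < w u -> w u < k -> m (rshift n u) = 0.
  move=> lt_vu lt_uk; apply: (standard_sorted std_m _ lt_vu lt_uk); first by lia.
  move=> l lt_l lt_lk; apply: contraL lt_lk => bar_l; rewrite -leqNgt.
  by apply: min_k; rewrite /P lt_l.
have deg_v u : m' (lshift n u) + m' (rshift n u) = m (lshift n u) + m (rshift n u).
  exact: (eqP (deg_m u)).
suff : ydeg_below k m < ydeg_below k m' by rewrite eq_y ltnn.
rewrite /ydeg_below (bigD1 v) //= [X in _ < X](bigD1 v) //= -addSn leq_add //.
  by have := deg_v v; lia.
apply: leq_sum => u /andP[lt_u ne_u]; have := deg_v u.
have [lt_uv|lt_vu|/val_inj/(can_inj wK) eq_u] := ltngtP (w u) (w v).
- by rewrite (eq_lt u lt_uv); lia.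
- by rewrite y0.
- by rewrite eq_u eqxx in ne_u.
Qed.

(** A standard leading monomial would be the only element of its class in the support, so its
    coefficient would be the class sum, which is 0. *)
Lemma lead_edge_ideal p m : binomial_edge_ideal K e p -> is_lead le p m ->
  exists i j, [/\ e i j, w i < w j & (xy i j <= m)%MM].
Proof.
move=> Jp [pm lead_m]; case: (boolP (standard m)) => [std_m|].
  have := pm; rewrite mcoeff_msupp -(@coeff_sum_eq0_pred1 _ _ (same_class m)) /=.
  - by rewrite (coeff_sum_edge_ideal _ Jp) ?eqxx //; apply: same_class_swap.
  - exact: same_class_refl.
  - by move=> m' pm' cl_m'; apply: standard_min (lead_m _ pm').
case/forallPn=> i /forallPn[j]; rewrite negb_imply => /andP[/and3P[e_ij lt_ij xi] yj].
exists i, j; split=> //; apply/mnm_lepP => q.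
have [v ->|v ->] := split_ordP q; rewrite ?xy_lshift ?xy_rshift.
  by case: eqVneq => // <-.
by case: eqVneq => // <-; rewrite lt0n.
Qed.

Lemma closed_quadratic_groebner :
  exists g : seq {mpoly K[n + n]},
    quadratic_groebner_basis le (binomial_edge_ideal K e) g.
Proof.
pose g := [seq binom_edge K q.1 q.2 |
  q : 'I_n * 'I_n <- enum {: 'I_n * 'I_n} & (q.1 < q.2) && e q.1 q.2].
have gP p : p \in g -> exists i j : 'I_n, [/\ i < j, e i j & p = binom_edge K i j].
  case/mapP=> -[i j]; rewrite mem_filter /= => /andP[/andP[lt_ij e_ij] _] ->.
  by exists i, j.
have mem_g (i j : 'I_n) : i < j -> e i j -> binom_edge K i j \in g.
  move=> lt_ij e_ij; apply/mapP; exists (i, j) => //.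
  by rewrite mem_filter /= lt_ij e_ij mem_enum.
have [[le_refl _] _ _ _ _] := relabelled_term_order wK.
exists g; split; first split.
- move=> p /gP[i [j [lt_ij e_ij ->]]]; split; first by apply: ideal_gen_gen; exists i, j.
  have ne_ij : xy i j != xy j i by apply: contraTneq lt_ij => /xy_inj[-> _]; rewrite ltnn.
  apply/eqP => /(congr1 (mcoeff (xy i j))).
  rewrite binom_edgeE mcoeffB !mcoeffX eqxx eq_sym (negbTE ne_ij) mcoeff0 subr0.
  by move/eqP; rewrite oner_eq0.
- move=> q; split; apply: lead_ideal_sub => p m.
    move=> Jp /(lead_edge_ideal Jp)[i [j [e_ij lt_ij le_m]]].
    have /andP[le_xy ne_xy] := relabelled_lt_xy wK wK' lt_ij.
    have lead_ij : is_lead le (binom_edge K i j) (xy i j).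
      by rewrite binom_edgeE; apply: is_lead_diffX.
    (* The basis is indexed by [i < j] in the numbering of the vertices; where the labels order [i]
       and [j] the other way, the basis element is the opposite binomial, with the same support. *)
    have [lt|lt|/val_inj eq] := ltngtP i j.
    + by exists (binom_edge K i j), (xy i j); rewrite mem_g.
    + exists (binom_edge K j i), (xy i j); rewrite mem_g 1?e_sym //; split=> //.
      have eq_s : msupp (binom_edge K j i) =i msupp (binom_edge K i j).
        apply: perm_mem; rewrite !binom_edgeE -opprB; exact: msuppN.
      by case: lead_ij => [? H]; split=> [|m']; rewrite eq_s //; apply: H.
    + by rewrite eq ltnn in lt_ij.
  move=> /gP[i [j [lt_ij e_ij ->]]] lead_m; exists (binom_edge K i j), m.
  by split=> //; [apply: ideal_gen_gen; exists i, j | apply/mnm_lepP => r; exact: leqnn].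
- move=> p /gP[i [j [_ _ ->]]]; rewrite binom_edgeE; apply: rpredB;
    by rewrite dhomogX /= mdeg_xy.
Qed.

End GroebnerFromClosed.

Theorem corollary4p7 (n : nat) (e : rel 'I_n) (K : fieldType)
    (e_sym : symmetric e) (e_irr : irreflexive e)
    (e_conn : graph_connected e) (e_noiso : no_isolated_vertex e) :
  (closed_graph e <-> closed_complex (clique_complex e)) /\
  (closed_graph e <->
    exists (le : rel 'X_{1..n + n}) (g : seq {mpoly K[n + n]}),
      term_order le /\
      quadratic_groebner_basis le (binomial_edge_ideal K e) g).
Proof.
have closed_labels : closed_graph e -> exists2 w : 'I_n -> 'I_n, bijective w &
    forall i j p q, e i j -> w i <= w p -> w p < w q -> w q <= w j -> e p q.
  by case=> w w_bij w_closed; exists w => //; apply: edge_convex; case: e_conn.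
split; split.
- by case=> w w_bij w_closed; apply: closed_graph_closed_complex w_closed.
- exact: closed_complex_closed_graph.
- case/closed_labels=> w [w' wK wK'] convex.
  have [g quad_g] := closed_quadratic_groebner K e_sym wK wK' convex.
  by exists (relabelled_le w'), g; split=> //; apply: relabelled_term_order wK.
- by case=> le [g [le_order quad_g]]; apply: quadratic_groebner_closed quad_g.
Qed.
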